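(* A graph $G$ satisfies $F(G)=2$ if and only if $G$ is isomorphic to one of the following $15$ graphs: $3K_1$; $K_2+K_1$; $K_2+K_2$; the star $K_{1,3}$; the cycle $C_4$; the paw (a triangle with one pendant edge attached to one of its vertices); the diamond $K_4-e$ ($K_4$ with one edge removed); $K_4$; the path $P_5$; the cycle $C_5$; the bull (a triangle with a pendant edge attached at each of two distinct vertices of the triangle); the house (the cycle $C_5$ with one chord added); the gem (a vertex adjacent to all four vertices of a path $P_4$); the path $P_6$; and the net (the corona of $K_3$: a triangle with one pendant edge attached at each of its three vertices).
   Context: All graphs are finite and simple. $K_n$, $P_n$, $C_n$ denote the complete graph, path, and cycle on $n$ vertices; $K_{r,t}$ is the complete bipartite graph; $G+H$ is the disjoint union, and $3K_1$ is three isolated vertices. Given a graph $G$ and a set $S\subseteq V(G)$, the forcing rule is: if a vertex $v\in S$ has exactly one neighbor $u$ not in $S$, then $u$ is added to $S$. A set $S$ is a failed zero-forcing set of $G$ if repeated application of the forcing rule starting from $S$ does not result in all vertices of $G$ being in $S$. The failed zero-forcing number $F(G)$ is the maximum cardinality of a failed zero-forcing set of $G$ (the empty set counts, with cardinality $0$). *)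

(* Defs.v *)
From mathcomp Require Import all_boot.

Set Implicit Arguments.
Unset Strict Implicit.
Unset Printing Implicit Defensive.

Record sgraph := SGraph {
  vertex :> finType;
  adj : rel vertex;
  adj_sym : symmetric adj;
  adj_irr : irreflexive adj
}.

Definition iso (G H : sgraph) : Prop :=
  exists2 f : G -> H, bijective f & forall x y, adj (f x) (f y) = adj x y.

Section ZeroForcing.
Variable G : sgraph.
Implicit Types S : {set G}.

Definition nbhd (v : G) : {set G} := [set u | adj v u].

Definition force_step : rel {set G} := fun S S' =>
  [exists v in S, exists u, (nbhd v :\: S == [set u]) && (S' == u |: S)].

Definition failed S : bool := ~~ connect force_step S [set: G].

(* Every graph with at least one vertex has a failed set, namely set0; on the
   empty graph the maximum ranges over no set and is 0. *)
Definition failed_number : nat := \max_(S : {set G} | failed S) #|S|.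

End ZeroForcing.

Section Families.
Variable n : nat.

Definition complete_rel : rel 'I_n := fun i j => i != j.
Lemma complete_sym : symmetric complete_rel.
Proof. by move=> i j; rewrite /complete_rel eq_sym. Qed.
Lemma complete_irr : irreflexive complete_rel.
Proof. by move=> i; rewrite /complete_rel eqxx. Qed.
Definition complete := SGraph complete_sym complete_irr.

Definition path_rel : rel 'I_n := fun i j => (i.+1 == j) || (j.+1 == i).
Lemma path_sym : symmetric path_rel.
Proof. by move=> i j; rewrite /path_rel orbC. Qed.
Lemma path_irr : irreflexive path_rel.
Proof. by move=> i; rewrite /path_rel orbb gtn_eqF. Qed.
Definition path_graph := SGraph path_sym path_irr.

(* ordS is the successor modulo n; the test i != j only matters for n = 1. *)
Definition cycle_rel : rel 'I_n :=
  fun i j => (i != j) && ((ordS i == j) || (ordS j == i)).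
Lemma cycle_sym : symmetric cycle_rel.
Proof. by move=> i j; rewrite /cycle_rel eq_sym orbC. Qed.
Lemma cycle_irr : irreflexive cycle_rel.
Proof. by move=> i; rewrite /cycle_rel eqxx. Qed.
Definition cycle_graph := SGraph cycle_sym cycle_irr.

End Families.

Section CompleteBipartite.
Variables r t : nat.

Definition bipartite_rel : rel ('I_r + 'I_t)%type := fun x y =>
  match x, y with inl _, inr _ | inr _, inl _ => true | _, _ => false end.
Lemma bipartite_sym : symmetric bipartite_rel.
Proof. by move=> [?|?] [?|?]. Qed.
Lemma bipartite_irr : irreflexive bipartite_rel.
Proof. by move=> [?|?]. Qed.
Definition complete_bipartite := SGraph bipartite_sym bipartite_irr.

End CompleteBipartite.

Section DisjointUnion.
Variables G H : sgraph.

Definition union_rel : rel (G + H)%type := fun x y =>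
  match x, y with
  | inl u, inl v => adj u v
  | inr u, inr v => adj u v
  | _, _ => false
  end.
Lemma union_sym : symmetric union_rel.
Proof. by move=> [?|?] [?|?] //=; apply: adj_sym. Qed.
Lemma union_irr : irreflexive union_rel.
Proof. by move=> [?|?] /=; apply: adj_irr. Qed.
Definition disjoint_union := SGraph union_sym union_irr.

End DisjointUnion.

Section NewVertex.
Variables (G : sgraph) (A : {set G}).

(* The new vertex is None; its neighbourhood is A. *)
Definition new_vertex_rel : rel (option G) := fun x y =>
  match x, y with
  | Some u, Some v => adj u v
  | Some u, None | None, Some u => u \in A
  | None, None => false
  end.
Lemma new_vertex_sym : symmetric new_vertex_rel.
Proof. by move=> [?|] [?|] //=; apply: adj_sym. Qed.
Lemma new_vertex_irr : irreflexive new_vertex_rel.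
Proof. by move=> [?|] //=; apply: adj_irr. Qed.
Definition add_vertex := SGraph new_vertex_sym new_vertex_irr.

End NewVertex.

Definition add_pendant (G : sgraph) (v : G) := add_vertex [set v].
Definition add_dominating (G : sgraph) := add_vertex [set: G].

Section Edges.
Variables (G : sgraph) (a b : G).

Definition is_edge : rel G := fun x y => [set x; y] == [set a; b].

Definition add_edge_rel : rel G :=
  fun x y => adj x y || (x != y) && is_edge x y.
Lemma add_edge_sym : symmetric add_edge_rel.
Proof. by move=> x y; rewrite /add_edge_rel /is_edge adj_sym eq_sym setUC. Qed.
Lemma add_edge_irr : irreflexive add_edge_rel.
Proof. by move=> x; rewrite /add_edge_rel adj_irr eqxx. Qed.
Definition add_edge := SGraph add_edge_sym add_edge_irr.

Definition del_edge_rel : rel G := fun x y => adj x y && ~~ is_edge x y.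
Lemma del_edge_sym : symmetric del_edge_rel.
Proof. by move=> x y; rewrite /del_edge_rel /is_edge adj_sym setUC. Qed.
Lemma del_edge_irr : irreflexive del_edge_rel.
Proof. by move=> x; rewrite /del_edge_rel adj_irr. Qed.
Definition del_edge := SGraph del_edge_sym del_edge_irr.

End Edges.

Section Corona.
Variable G : sgraph.

(* inr v is the pendant vertex attached to inl v. *)
Definition corona_rel : rel (G + G)%type := fun x y =>
  match x, y with
  | inl u, inl v => adj u v
  | inl u, inr v | inr u, inl v => u == v
  | inr _, inr _ => false
  end.
Lemma corona_sym : symmetric corona_rel.
Proof. by move=> [u|u] [v|v] //=; rewrite ?(adj_sym u) // eq_sym. Qed.
Lemma corona_irr : irreflexive corona_rel.
Proof. by move=> [?|?] //=; apply: adj_irr. Qed.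
Definition corona := SGraph corona_sym corona_irr.

End Corona.

Definition paw := @add_pendant (complete 3) (inord 0).
Definition diamond := @del_edge (complete 4) (inord 0) (inord 1).
Definition bull := @add_pendant paw (Some (inord 1)).
Definition house := @add_edge (cycle_graph 5) (inord 0) (inord 2).
Definition gem := add_dominating (path_graph 4).
Definition net := corona (complete 3).

(* Main.v *)
(* Call S stalled if no vertex of S has exactly one neighbour outside S. A set is
   failed iff it extends to a stalled proper subset, so F(G) >= m iff there is a
   stalled proper subset of size at least m.  If n >= 5 and G is disconnected,
   a union of components or its complement is stalled of size at least 3, hence
   F(G) <= 2 forces G to be connected.  Suppose G is connected with n >= 7, and
   pick six vertices inducing a connected graph M.  Whether a subset of these six
   is stalled in G depends only on M and on the number of neighbours, capped at 2,
   that each of the six has among the other vertices.  For every connected M and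
   every such numbers, a computation finds a stalled subset of size at least 3, so
   F(G) >= 3.  The graphs with n <= 6 are enumerated. *)
Require Import Defs.
From mathcomp Require Import all_boot.

Set Implicit Arguments.
Unset Strict Implicit.
Unset Printing Implicit Defensive.

(** * Stalled sets and the failed zero-forcing number *)

Section Stalled.
Variable G : sgraph.
Implicit Types S T : {set G}.

Definition stalled S : bool := [forall v in S, #|nbhd v :\: S| != 1].

Lemma stalledP S :
  reflect (forall v, v \in S -> #|nbhd v :\: S| != 1) (stalled S).
Proof. exact: 'forall_in_idP. Qed.

Lemma stalled_connect S T : stalled S -> connect (@force_step G) S T -> T = S.
Proof.
move=> /stalledP st /connectP[[|S1 p] //= /andP[/exists_inP[v vS]] + _ _].
case/existsP=> u /andP[/eqP Nv _].
by have := st v vS; rewrite Nv cards1.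
Qed.

(** A forcing step keeps a failed set failed and shrinks its complement, so forcing ends at a
    stalled set, which is proper because it is still failed. *)
Lemma failed_sub_stalled S : failed S ->
  exists2 T, stalled T && (T != setT) & S \subset T.
Proof.
have [n] := ubnP #|~: S|; elim: n S => // n IHn S ltSn fS.
have [st|] := boolP (stalled S).
  exists S => //; rewrite st; apply: contraNneq fS => ->; exact: connect0.
rewrite negb_forall_in => /exists_inP[v vS]; rewrite negbK => /cards1P[u Nv].
have uNS : u \notin S by have := set11 u; rewrite -Nv inE => /andP[].
have step : force_step S (u |: S).
  by apply/exists_inP; exists v => //; apply/existsP; exists u; rewrite Nv !eqxx.
have [||T stT sub] := IHn (u |: S).
- rewrite -ltnS; apply: leq_trans ltSn; rewrite ltnS; apply: proper_card.
  by rewrite setCU properE subsetIr; apply/subsetPn; exists u; rewrite !inE ?uNS ?eqxx.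
- by apply: contra fS => /(connect_trans (connect1 step)).
by exists T => //; apply: subset_trans sub; apply: subsetUr.
Qed.

(** A stalled proper set is itself failed; conversely a failed set of maximum size extends to one.
    Positivity of [m] ensures that some failed set exists, so that the maximum is attained. *)
Lemma leq_failed_number m : 0 < m ->
  (m <= failed_number G) = [exists T : {set G}, [&& stalled T, T != setT & m <= #|T|]].
Proof.
move=> m_gt0; apply/idP/existsP => [le_m|[T /and3P[stT pT leT]]]; last first.
  apply: leq_trans leT _; apply: (@leq_bigmax_cond _ (@failed G) (fun S => #|S|)).
  by apply: contra pT => /(stalled_connect stT) ->.
have [S fS] : {S | S \in @failed G & failed_number G = #|S|}.
  apply: eq_bigmax_cond; rewrite lt0n; apply: contraTneq le_m => /card0_eq none.
  rewrite /failed_number big_pred0 -?ltnNge // => S; exact: none.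
move=> FS; have [T /andP[stT pT] sub] := failed_sub_stalled fS.
by exists T; rewrite stT pT (leq_trans le_m) // FS subset_leq_card.
Qed.

(** Otherwise [T] and its complement are both stalled and proper, hence of size at most 2 each,
    leaving at most 4 vertices. *)
Lemma exists_crossing_edge T : 4 < #|G| -> failed_number G < 3 ->
  T != set0 -> T != setT -> exists v u, [/\ v \in T, u \notin T & adj v u].
Proof.
move=> G_gt4; rewrite ltnNge leq_failed_number // => /existsPn noS T0 TT.
have [/exists_inP[v vT /existsP[u /andP[uT vu]]]|noE] :=
  boolP [exists v in T, exists u, (u \notin T) && adj v u]; first by exists v, u.
have{noE} adjT v u : adj v u -> (v \in T) = (u \in T).
  have{noE} sub x y : adj x y -> x \in T -> y \in T.
    move=> xy xT; apply: contraNT noE => yT.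
    by apply/exists_inP; exists x => //; apply/existsP; exists y; rewrite yT.
  by move=> vu; apply/idP/idP; apply: sub; rewrite // adj_sym.
have st S : (forall v u, adj v u -> (v \in S) = (u \in S)) -> stalled S.
  move=> adjS; apply/stalledP => v vS; suff -> : nbhd v :\: S = set0 by rewrite cards0.
  by apply/setP => u; rewrite !inE andbC; apply/negP => /andP[/adjS <-]; rewrite vS.
have := noS T; rewrite st // TT -ltnNge => ltT.
have := noS (~: T); rewrite st; last by move=> v u /adjT; rewrite !inE => ->.
have -> /= : ~: T != setT by apply: contraNneq T0 => CT; rewrite -[T]setCK CT setCT.
rewrite -ltnNge => ltC.
by move: G_gt4; rewrite -(cardsC T) ltnNge (leq_add (ltT : _ <= 2) (ltC : _ <= 2)).
Qed.

End Stalled.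

(** * Enumeration of Boolean matrices and the covering test *)

Fixpoint bitseqs n : seq bitseq :=
  if n is n'.+1 then [seq true :: s | s <- bitseqs n'] ++ [seq false :: s | s <- bitseqs n']
  else [:: [::]].

Lemma mem_bitseqs s n : (s \in bitseqs n) = (size s == n).
Proof.
elim: n s => [|n IHn] [|b s] //=; rewrite mem_cat.
  by apply/orP=> -[] /mapP[].
have inj (c : bool) : injective (cons c) by move=> x y [].
have no c : (c :: s \in [seq ~~ c :: s | s <- bitseqs n]) = false.
  by apply/mapP => -[? _]; case: c.
by case: b; have /= := no true; have /= := no false; move=> Hf Ht;
  rewrite ?Hf ?Ht ?orbF (mem_map (inj _)) IHn.
Qed.

Definition extend (M : seq bitseq) (r : bitseq) : seq bitseq :=
  rcons [seq rcons p.1 p.2 | p <- zip M r] (rcons r false).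

(** Graphs are built one vertex at a time; [P] restricts the adjacency of each new vertex to the
    earlier ones. *)
Fixpoint matrices (P : pred bitseq) n : seq (seq bitseq) :=
  if n is n'.+1 then [seq extend M r | M <- matrices P n', r <- filter P (bitseqs n')]
  else [:: [::]].

Definition out (r s : bitseq) : nat := count (fun p => p.1 && ~~ p.2) (zip r s).

Definition has_stalled m (M : seq bitseq) : bool :=
  has (fun s => [&& m <= count id s, ~~ all id s &
                    all (fun p => p.1 ==> (out p.2 s != 1)) (zip s M)])
      (bitseqs (size M)).

Definition permuted (M : seq bitseq) (p : seq nat) : seq bitseq :=
  [seq [seq nth false (nth [::] M i) j | j <- p] | i <- p].

Definition isomorphic (M : seq bitseq) (Ns : seq (seq bitseq)) : bool :=
  has (fun p => permuted M p \in Ns) (permutations (iota 0 (size M))).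

(* For a vertex of a stalled candidate with o neighbours outside the candidate but
   inside the six chosen vertices: the capped number of further neighbours which
   would make it force; 3 stands for no constraint. *)
Definition forbidden (b : bool) (o : nat) : nat :=
  if b then match o with 0 => 1 | 1 => 0 | _ => 3 end else 3.

(* Every e in {0,1,2}^k differs in all entries from some c in cs. The conditional
   replaces a disjunction because vm_compute would evaluate both disjuncts. *)
Fixpoint covers k (cs : seq (seq nat)) : bool :=
  if has (all (eq_op 3)) cs then true else
  if k is k'.+1 then
    all (fun v => covers k' [seq behead c | c <- cs & head 3 c != v]) (iota 0 3)
  else false.

(** The entries of [e] are consumed one by one, keeping the rows that differ from it so far. A row
    whose remaining entries are all 3 avoids the rest of [e]. *)
Lemma coversP k cs (e : seq nat) : covers k cs -> size e = k -> all (gtn 3) e ->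
  has (fun c => all (fun p => p.1 != p.2) (zip c e)) cs.
Proof.
have base cs' e' : has (all (eq_op 3)) cs' -> all (gtn 3) e' ->
    has (fun c => all (fun p => p.1 != p.2) (zip c e')) cs'.
  move=> /hasP[c c_cs c3] e3; apply/hasP; exists c => //.
  elim: c e' c3 e3 {c_cs} => [|x c IHc] [|y e'] //= /andP[/eqP <- c3] /andP[y3 e3].
  by rewrite IHc // andbT gtn_eqF.
elim: k cs e => [|k IHk] cs e /=; case: ifP => [h _ _|_ //]; try exact: base.
case: e => //= v e; rewrite andbT => /and3P[c0 c1 c2] [se] /andP[v3 e3].
have /IHk/(_ se e3)/hasP[c'] : covers k [seq behead c | c <- cs & head 3 c != v].
  by case: v v3 => [|[|[|v]]].
case/mapP=> c; rewrite mem_filter => /andP[hc c_cs] -> allc.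
by apply/hasP; exists c => //; case: c hc allc {c_cs} => //= h t -> ->.
Qed.

(* New row of an adjacency matrix: the added vertex has an earlier neighbour,
   unless it is the first one. *)
Definition linked (r : bitseq) : bool := nilp r || has id r.

(** One row per candidate of size at least 3; the candidate is stalled when the capped outer degrees
    avoid its row in every entry. *)
Definition constraints (M : seq bitseq) : seq (seq nat) :=
  [seq [seq forbidden p.1 (out p.2 s) | p <- zip s M]
  | s <- bitseqs (size M) & 2 < count id s].

(** * Adjacency matrices along vertex sequences *)

Section AdjacencyMatrix.
Variable G : sgraph.
Implicit Types (s t : seq G) (T : {set G}).

Definition adjmx s : seq bitseq := [seq [seq adj x y | y <- s] | x <- s].

Lemma size_adjmx s : size (adjmx s) = size s.
Proof. exact: size_map. Qed.

Lemma adjmx_rcons s x : adjmx (rcons s x) = extend (adjmx s) [seq adj x y | y <- s].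
Proof.
rewrite /adjmx /extend !map_rcons adj_irr zip_map -map_comp; congr rcons.
by apply: eq_map => y /=; rewrite map_rcons adj_sym.
Qed.

Lemma adjmx_rcons_matrices P s x : adjmx s \in matrices P (size s) ->
  P [seq adj x y | y <- s] -> adjmx (rcons s x) \in matrices P (size s).+1.
Proof.
move=> sP xP; rewrite adjmx_rcons; apply: allpairs_f => //.
by rewrite mem_filter xP mem_bitseqs size_map eqxx.
Qed.

Lemma adjmx_matrices s : adjmx s \in matrices predT (size s).
Proof.
by elim/last_ind: s => // s x IHs; rewrite size_rcons adjmx_rcons_matrices.
Qed.

(** The sequence grows greedily: an edge leaving the vertices chosen so far gives the next one. *)
Lemma exists_linked n : 4 < #|G| -> failed_number G < 3 -> n <= #|G| ->
  exists s, [/\ uniq s, size s = n & adjmx s \in matrices linked n].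
Proof.
move=> G_gt4 FG; elim: n => [|n IHn] le_n; first by exists [::].
have [s [us ss sM]] := IHn (ltnW le_n).
have cs : #|[set x in s]| = n by rewrite cardsE (card_uniqP us).
suff [x xs Lx] : exists2 x, x \notin s & linked [seq adj x y | y <- s].
  exists (rcons s x); rewrite rcons_uniq xs us size_rcons ss; split=> //.
  by rewrite -ss adjmx_rcons_matrices ?ss.
have [s0|s0] := eqVneq s [::].
  have /card_gt0P[x _] : 0 < #|G| by apply: leq_trans G_gt4.
  by exists x; rewrite s0.
have [||v [u [vs us' vu]]] := exists_crossing_edge (T := [set x in s]) G_gt4 FG.
- by rewrite -card_gt0 cs -ss lt0n size_eq0.
- by apply: contraTneq le_n => sT; rewrite -leqNgt -[n]cs sT cardsT.
rewrite !inE in vs us'; exists u => //; apply/orP; right.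
by rewrite has_map; apply/hasP; exists v => //=; rewrite adj_sym.
Qed.

Lemma bitseq_set s b : uniq s -> size b = size s ->
  exists2 T : {set G}, T \subset s & b = [seq y \in T | y <- s].
Proof.
move=> us sb; exists [set y in mask b s].
  by apply/subsetP => y; rewrite inE => /mem_mask.
case: s us sb => [|x0 s] us sb; first by apply/size0nil.
apply: (@eq_from_nth _ false) => [|i]; rewrite ?size_map // sb => lti.
by rewrite (nth_map x0) // inE in_mask // mem_nth // index_uniq.
Qed.

Lemma count_mem_set s T : uniq s -> T \subset s -> count [in T] s = #|T|.
Proof.
move=> us sub; rewrite -size_filter -(card_uniqP (filter_uniq _ us)).
apply: eq_card => y; rewrite mem_filter andb_idr //; exact: (subsetP sub).
Qed.

Lemma card_nbhdD s T x : uniq s -> T \subset s ->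
  #|nbhd x :\: T| = out [seq adj x y | y <- s] [seq y \in T | y <- s]
                    + #|nbhd x :\: [set y in s]|.
Proof.
move=> us sub; rewrite -(cardsID [set y in s] (nbhd x :\: T)); congr (_ + _).
  rewrite /out zip_map count_map -size_filter -(card_uniqP (filter_uniq _ us)).
  by apply: eq_card => y; rewrite !inE mem_filter /= [~~ _ && _]andbC.
apply: eq_card => y; rewrite !inE andbCA; case: (boolP (y \in s)) => [_|ys] /=.
  by rewrite andbF.
by rewrite (contra (subsetP sub y) ys).
Qed.

Lemma has_stalledE m s : uniq s -> (forall x, x \in s) ->
  has_stalled m (adjmx s) = [exists T : {set G}, [&& stalled T, T != setT & m <= #|T|]].
Proof.
move=> us sG; have sub (T : {set G}) : T \subset s by apply/subsetP.
have E (T : {set G}) : [&& stalled T, T != setT & m <= #|T|] =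
    [&& m <= count id [seq y \in T | y <- s], ~~ all id [seq y \in T | y <- s] &
        all (fun p => p.1 ==> (out p.2 [seq y \in T | y <- s] != 1))
            (zip [seq y \in T | y <- s] (adjmx s))].
  rewrite count_map count_mem_set // all_map zip_map all_map andbC -andbA andbCA.
  congr [&& _, _ & _].
    congr (~~ _); apply/eqP/allP => [-> y _|TT]; first exact: in_setT.
    by apply/setP => y; rewrite inE; apply: TT.
  (* Here [s] lists all vertices, so the term for neighbours outside [s] vanishes. *)
  have card x : #|nbhd x :\: T| = out [seq adj x y | y <- s] [seq y \in T | y <- s].
    rewrite (card_nbhdD x us (sub T)) [X in _ + X](_ : _ = 0) ?addn0 //.
    by apply/eqP; rewrite cards_eq0 setD_eq0; apply/subsetP => y _; rewrite inE.
  apply/stalledP/allP => st x; last by move=> xT; have /implyP := st x (sG x); rewrite card; apply.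
  by move=> _; apply/implyP => /st; rewrite card.
apply/hasP/existsP => [[b]|[T]].
  rewrite mem_bitseqs size_adjmx => /eqP /(bitseq_set us)[T _ ->].
  by rewrite -E; exists T.
rewrite E => ?; exists [seq y \in T | y <- s] => //.
by rewrite mem_bitseqs size_map size_adjmx.
Qed.

Lemma permuted_adjmx s p : uniq s -> perm_eq p (iota 0 (size s)) ->
  exists2 t, perm_eq t s & permuted (adjmx s) p = adjmx t.
Proof.
case Ds: s => [|x0 s1]; first by move=> _ /perm_size/size0nil ->; exists [::].
rewrite -{s1}Ds => us ps; exists [seq nth x0 s i | i <- p].
  by rewrite -[X in perm_eq _ X](mkseq_nth x0) perm_map.
have lt i : i \in p -> i < size s by rewrite (perm_mem ps) mem_iota.
rewrite /permuted /adjmx -map_comp; apply/eq_in_map => i /lt lti /=.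
rewrite -map_comp; apply/eq_in_map => j /lt ltj /=.
by rewrite (nth_map x0) // (nth_map x0).
Qed.

End AdjacencyMatrix.
Arguments adjmx {G} s.
Arguments has_stalledE {G} m {s}.

(** * Isomorphism in terms of matrices *)

Lemma isomorphicP (G : sgraph) (s : seq G) Ns : uniq s -> isomorphic (adjmx s) Ns ->
  exists2 t : seq G, perm_eq t s & adjmx t \in Ns.
Proof.
move=> us /hasP[p]; rewrite mem_permutations size_adjmx => ps.
by have [t ts ->] := permuted_adjmx us ps; exists t.
Qed.

Lemma adjmx_iso (G H : sgraph) (s : seq G) (t : seq H) :
  uniq s -> (forall x, x \in s) -> uniq t -> (forall y, y \in t) ->
  0 < size s -> adjmx s = adjmx t -> iso G H.
Proof.
move=> us sG ut tH s_gt0 st.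
have eqs : size s = size t by rewrite -(size_adjmx s) st size_adjmx.
case: s us sG s_gt0 st eqs => // x0 s'; set s := x0 :: s' => us sG _ st eqs.
case: t ut tH st eqs => // y0 t'; set t := y0 :: t' => ut tH st eqs.
(* Vertices at equal positions in [s] and [t] correspond. *)
pose f x := nth y0 t (index x s); pose g y := nth x0 s (index y t).
have ltx x : index x s < size s by rewrite index_mem.
have lty y : index y t < size t by rewrite index_mem.
exists f; first exists g => [x|y].
- by rewrite /f /g index_uniq ?nth_index // -eqs.
- by rewrite /f /g index_uniq ?nth_index // eqs.
move=> x y; have := congr1 (fun M => nth false (nth [::] M (index x s)) (index y s)) st.
by rewrite !(nth_map x0) // !(nth_map y0) -?eqs // !nth_index.
Qed.

Lemma iso_adjmx (G H : sgraph) (t : seq H) : iso G H -> uniq t -> (forall y, y \in t) ->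
  exists s : seq G, [/\ uniq s, forall x, x \in s & adjmx s = adjmx t].
Proof.
case=> f [g fK gK] fadj ut tH; exists (map g t).
rewrite map_inj_uniq; last exact: can_inj gK.
split=> // [x|]; first by rewrite -[x]fK map_f.
rewrite /adjmx -map_comp; apply: eq_map => x /=; rewrite -map_comp; apply: eq_map => y /=.
by rewrite -fadj !gK.
Qed.

(** * The fifteen target graphs as matrices *)

(* Vertices are numbered in the order of [enum]: [None] first, [inl] before [inr]. *)
Definition edge_matrix n (E : seq (nat * nat)) : seq bitseq :=
  [seq [seq ((i, j) \in E) || ((j, i) \in E) | j <- iota 0 n] | i <- iota 0 n].

Definition targets : seq sgraph :=
  [:: disjoint_union (disjoint_union (complete 1) (complete 1)) (complete 1);
      disjoint_union (complete 2) (complete 1);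
      disjoint_union (complete 2) (complete 2);
      complete_bipartite 1 3; cycle_graph 4; paw; diamond; complete 4;
      path_graph 5; cycle_graph 5; bull; house; gem; path_graph 6; net].

Definition target_matrices : seq (seq bitseq) :=
  [:: edge_matrix 3 [::];
      edge_matrix 3 [:: (0, 1)];
      edge_matrix 4 [:: (0, 1); (2, 3)];
      edge_matrix 4 [:: (0, 1); (0, 2); (0, 3)];
      edge_matrix 4 [:: (0, 1); (1, 2); (2, 3); (3, 0)];
      edge_matrix 4 [:: (0, 1); (1, 2); (2, 3); (3, 1)];
      edge_matrix 4 [:: (0, 2); (0, 3); (1, 2); (1, 3); (2, 3)];
      edge_matrix 4 [:: (0, 1); (0, 2); (0, 3); (1, 2); (1, 3); (2, 3)];
      edge_matrix 5 [:: (0, 1); (1, 2); (2, 3); (3, 4)];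
      edge_matrix 5 [:: (0, 1); (1, 2); (2, 3); (3, 4); (4, 0)];
      edge_matrix 5 [:: (0, 3); (1, 2); (2, 3); (3, 4); (4, 2)];
      edge_matrix 5 [:: (0, 1); (1, 2); (2, 3); (3, 4); (4, 0); (0, 2)];
      edge_matrix 5 [:: (0, 1); (0, 2); (0, 3); (0, 4); (1, 2); (2, 3); (3, 4)];
      edge_matrix 6 [:: (0, 1); (1, 2); (2, 3); (3, 4); (4, 5)];
      edge_matrix 6 [:: (0, 1); (1, 2); (2, 0); (0, 3); (1, 4); (2, 5)]].

(** Replaces an equality of sets by a Boolean formula suited to computation. *)
Lemma is_edgeE (G : sgraph) (a b x y : G) :
  is_edge a b x y = (x == a) && (y == b) || (x == b) && (y == a).
Proof.
apply/eqP/idP => [E|/orP[]/andP[/eqP-> /eqP->] //]; last exact: setUC.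
have /set2P X : x \in [set a; b] by rewrite -E set21.
have /set2P Y : y \in [set a; b] by rewrite -E set22.
have /set2P A : a \in [set x; y] by rewrite E set21.
have /set2P B : b \in [set x; y] by rewrite E set22.
by case: X Y A B => -> [] -> [] A [] B; rewrite ?A ?B !eqxx ?orbT.
Qed.

Lemma targetsE : [seq adjmx (enum (vertex H)) | H <- targets] = target_matrices.
Proof.
have sumE (A B : finType) : enum {: A + B} = map inl (enum A) ++ map inr (enum B).
  by rewrite [LHS]enumT unlock /= /sum_enum !enumT.
have optE (A : finType) : enum {: option A} = None :: map Some (enum A).
  by rewrite [LHS]enumT unlock /= /option_enum !enumT.
have e0 : enum 'I_0 = [::] by apply/size0nil; rewrite size_enum_ord.
(* The named vertices take the [lift ord0] form in which [enum_ordSl] lists ordinals. *)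
have i0 n : inord 0 = ord0 :> 'I_n.+1 by apply: val_inj; rewrite /= inordK.
have i1 n : inord 1 = lift ord0 ord0 :> 'I_n.+2 by apply: val_inj; rewrite /= inordK.
have i2 n : inord 2 = lift ord0 (lift ord0 ord0) :> 'I_n.+3.
  by apply: val_inj; rewrite /= inordK.
rewrite /= /adjmx; do ![congr (_ :: _)].
all: rewrite ?(sumE, optE, enum_ordSl, e0) /= ?(inE, i0, i1, i2).
all: rewrite /del_edge_rel /add_edge_rel ?is_edgeE.
all: by vm_compute.
Qed.

(** * Finite computations *)

Lemma small_targets : all (fun n => all (fun M =>
    if has_stalled 3 M then true else
    if has_stalled 2 M then isomorphic M target_matrices else true)
  (matrices predT n)) (iota 0 6).
Proof. by vm_compute. Qed.

Lemma linked6_targets : all (fun M =>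
  if has_stalled 3 M then true else isomorphic M target_matrices) (matrices linked 6).
Proof. by vm_compute. Qed.

Lemma targets_stalled :
  all (fun M => has_stalled 2 M && ~~ has_stalled 3 M) target_matrices.
Proof. by vm_compute. Qed.

(** Whatever the outer degrees of six linked vertices, some candidate among them is stalled; this
    excludes seven or more vertices. *)
Lemma linked6_covers : all (fun M => covers 6 (constraints M)) (matrices linked 6).
Proof. by vm_compute. Qed.

(** * From computation to classification *)

Lemma covers_stalled (G : sgraph) (s : seq G) : uniq s ->
  covers (size s) (constraints (adjmx s)) ->
  exists T : {set G}, [/\ T \subset s, stalled T & 2 < #|T|].
Proof.
(* Capping at 2 loses nothing: stalling only asks whether a total is exactly 1. *)
move=> us cov; pose e x := minn 2 #|nbhd x :\: [set y in s]|.
have e3 : all (gtn 3) (map e s) by apply/allP => _ /mapP[x _ ->]; rewrite /= ltnS geq_minl.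
have /hasP[_ /mapP[b + ->]] := coversP cov (size_map e s) e3.
rewrite mem_filter mem_bitseqs size_adjmx => /andP[+ /eqP sb].
have [T sub ->] := bitseq_set us sb.
rewrite count_map count_mem_set // => gt2 all_e; exists T; split=> //.
apply/stalledP => x xT; have xs := subsetP sub x xT.
move: all_e; rewrite /adjmx !zip_map -map_comp zip_map all_map => /allP/(_ x xs) /=.
rewrite xT (card_nbhdD x us sub) /e.
by case: (out _ _) => [|[|o]]; case: #|_| => [|[|m]].
Qed.

Lemma failed_number2P (G : sgraph) : failed_number G = 2 <->
  exists s : seq G, [/\ uniq s, forall x, x \in s & adjmx s \in target_matrices].
Proof.
split=> [FG|[s [us sG /(allP targets_stalled)]]]; last first.
  rewrite !(has_stalledE _ us sG) -!leq_failed_number // => /andP[le2 lt3].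
  by apply/eqP; rewrite eqn_leq le2 andbT -ltnS ltnNge.
have lt3 : failed_number G < 3 by rewrite FG.
have wrap (s : seq G) : uniq s -> (forall x, x \in s) ->
    isomorphic (adjmx s) target_matrices ->
  exists s : seq G, [/\ uniq s, forall x, x \in s & adjmx s \in target_matrices].
  move=> us sG /(isomorphicP us)[t ts tM]; exists t.
  by rewrite (perm_uniq ts); split=> // x; rewrite (perm_mem ts).
have no3 (s : seq G) : uniq s -> (forall x, x \in s) -> has_stalled 3 (adjmx s) = false.
  by move=> us sG; rewrite has_stalledE // -leq_failed_number // FG.
(* Up to five vertices all matrices are checked, connected or not. *)
have [le5|gt5] := leqP #|G| 5.
  have mG x : x \in enum G by rewrite mem_enum.
  apply: (wrap (enum G)) => //; first exact: enum_uniq.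
  have := allP small_targets #|G|; rewrite mem_iota => /(_ le5)/allP/(_ (adjmx (enum G))).
  rewrite cardE adjmx_matrices no3 ?enum_uniq // has_stalledE ?enum_uniq //.
  by rewrite -leq_failed_number // FG; apply.
have [s [us ss sM]] := exists_linked (ltnW gt5) lt3 gt5.
have cs : #|[set y in s]| = 6 by rewrite cardsE (card_uniqP us).
(* Either the six vertices are all of [G], or a vertex [z] outside them makes the stalled set found
   inside [s] proper. *)
have [sG|/subsetPn[z _ zs]] := boolP ([set: G] \subset [set y in s]).
  have {}sG x : x \in s by have := subsetP sG x; rewrite !inE; apply.
  by have := allP linked6_targets _ sM; rewrite no3 //; apply: wrap.
have := allP linked6_covers _ sM; rewrite -ss => /(covers_stalled us)[T [sub stT gt2]].
have : 3 <= failed_number G.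
  rewrite leq_failed_number //; apply/existsP; exists T; rewrite stT gt2 andbT /=.
  by apply: contraNneq zs => TT; rewrite inE (subsetP sub) // TT inE.
by rewrite FG.
Qed.

Theorem theorem2p3 (G : sgraph) :
  failed_number G = 2 <->
  iso G (disjoint_union (disjoint_union (complete 1) (complete 1)) (complete 1))
  \/ iso G (disjoint_union (complete 2) (complete 1))
  \/ iso G (disjoint_union (complete 2) (complete 2))
  \/ iso G (complete_bipartite 1 3)
  \/ iso G (cycle_graph 4)
  \/ iso G paw
  \/ iso G diamond
  \/ iso G (complete 4)
  \/ iso G (path_graph 5)
  \/ iso G (cycle_graph 5)
  \/ iso G bull
  \/ iso G house
  \/ iso G gem
  \/ iso G (path_graph 6)
  \/ iso G net.
Proof.
have cards := (card_sum, card_option, card_ord).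
split=> [/failed_number2P[s [us sG]]|].
  have from (H : sgraph) : adjmx s = adjmx (enum H) -> 0 < #|H| -> iso G H.
    move=> sH H_gt0; apply: (adjmx_iso us sG (enum_uniq H) (mem_enum H) _ sH).
    by rewrite -size_adjmx sH size_adjmx -cardE.
  rewrite -targetsE /= !inE.
  (* Fourteen splits separate the fifteen targets; the last is left for the next line. *)
  do 14![case/orP=> [/eqP/from h|sM]; [by left; apply: h; rewrite ?cards|right; move: sM]].
  by move/eqP/from; apply; rewrite ?cards.
have to (H : sgraph) : iso G H -> adjmx (enum H) \in target_matrices -> failed_number G = 2.
  move=> GH HM; apply/failed_number2P.
  have [s [us sG sH]] := iso_adjmx GH (enum_uniq H) (mem_enum H).
  by exists s; rewrite sH.
rewrite -targetsE in to.
do 14![case=> [/to h|]; first by apply: h; rewrite !inE eqxx ?orbT].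
by move/to; apply; rewrite !inE eqxx ?orbT.
Qed.
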